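(* For positive integers $n,k$ with $1\leq k\leq n$, $$E(4n,k)=\sum_{\substack{\alpha_1+\cdots+\alpha_k=n\\ \alpha_i\geq1}}\zeta(4\alpha_1,\ldots,4\alpha_k)=\frac{2^{2n+1}\pi^{4n}}{(4n+2)!}\sum_{q=0}^{n-k}(-1)^{n-q-k}\binom{n-q}{k}\binom{4n+2}{4q}\sum_{\substack{q_1+q_2=2q\\ q_1,q_2\geq 0}}\binom{4q}{2q_1}(-1)^{q_1}2^{2q}B_{2q_1}\!\left(\tfrac12\right)B_{2q_2}\!\left(\tfrac12\right).$$
   Context: For positive integers $\alpha_1,\ldots,\alpha_r$ with $\alpha_r\geq 2$, $\zeta(\alpha_1,\ldots,\alpha_r)=\sum_{1\leq k_1<\cdots<k_r}k_1^{-\alpha_1}\cdots k_r^{-\alpha_r}$. The Bernoulli polynomials $B_n(x)$ are defined by $\frac{te^{xt}}{e^t-1}=\sum_{n\geq 0}B_n(x)\frac{t^n}{n!}$. *)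

(* Defs.v *)
From HB Require Import structures.
From mathcomp Require Import all_boot all_order all_algebra.
From mathcomp Require Import all_classical all_reals all_analysis.

Set Implicit Arguments.
Unset Strict Implicit.
Unset Printing Implicit Defensive.

Import Order.TTheory GRing.Theory Num.Theory.

Local Open Scope ring_scope.

(* A formal power series \sum_n a_n t^n over A is its coefficient sequence
   a : nat -> A. *)
Section FormalPowerSeries.
Variable A : comUnitRingType.
Implicit Types a b c : nat -> A.

Definition fps_mul a b (n : nat) : A := \sum_(i < n.+1) a i * b (n - i)%N.

Fixpoint fps_inv_seq a (n : nat) : seq A :=
  if n is m.+1 then
    let s := fps_inv_seq a m in
    rcons s (if m is p.+1 then
               - (a 0%N)^-1 * \sum_(i < m) a i.+1 * s`_(p - i)
             else (a 0%N)^-1)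
  else [::].

(* The multiplicative inverse of a, meaningful when a 0 is a unit;
   fps_inv_seq a n lists its first n coefficients. *)
Definition fps_inv a (n : nat) : A := (fps_inv_seq a n.+1)`_n.

Lemma size_fps_inv_seq a n : size (fps_inv_seq a n) = n.
Proof. by elim: n => //= n IHn; rewrite size_rcons IHn. Qed.

Lemma nth_fps_inv_seq a n i : (i < n)%N -> (fps_inv_seq a n)`_i = fps_inv a i.
Proof.
elim: n => // n IHn; rewrite ltnS leq_eqVlt => /predU1P[-> //|lt_in].
by rewrite [LHS]nth_rcons size_fps_inv_seq lt_in IHn.
Qed.

Lemma fps_inv0 a : fps_inv a 0 = (a 0%N)^-1.
Proof. by []. Qed.

Lemma fps_invS a n :
  fps_inv a n.+1 =
    - (a 0%N)^-1 * \sum_(i < n.+1) a i.+1 * fps_inv a (n - i)%N.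
Proof.
rewrite {1}/fps_inv [fps_inv_seq a n.+2]/= -/(fps_inv_seq a n.+1).
rewrite nth_rcons size_fps_inv_seq ltnn eqxx.
congr (_ * _); apply: eq_bigr => i _; congr (_ * _).
by rewrite -(@nth_fps_inv_seq a n.+1) // ltnS leq_subr.
Qed.

Lemma fps_mulV a n : a 0%N \is a GRing.unit ->
  fps_mul a (fps_inv a) n = (n == 0%N)%:R.
Proof.
move=> ua; rewrite /fps_mul big_ord_recl subn0.
case: n => [|n]; first by rewrite big_ord0 addr0 fps_inv0 mulrV.
by rewrite fps_invS mulrA mulrN mulrV // mulN1r addNr.
Qed.

Lemma fps_mul_coef a b N m : (m <= N)%N ->
  fps_mul a b m = ((\poly_(i < N.+1) a i) * (\poly_(i < N.+1) b i))`_m.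
Proof.
move=> lemN; rewrite coefM; apply: eq_bigr => i _; rewrite !coef_poly.
have -> : (i < N.+1)%N by apply: leq_trans (ltn_ord i) _.
by rewrite ifT // ltnS (leq_trans (leq_subr _ _)).
Qed.

Lemma fps_mulA a b c n :
  fps_mul a (fps_mul b c) n = fps_mul (fps_mul a b) c n.
Proof.
pose P (u : nat -> A) := \poly_(i < n.+1) u i.
have PE u (i : nat) : (i <= n)%N -> u i = (P u)`_i.
  by move=> lin; rewrite coef_poly ltnS lin.
transitivity ((P a * (P b * P c))`_n).
  rewrite coefM; apply: eq_bigr => i _.
  rewrite -PE; last by rewrite -ltnS.
  by rewrite (@fps_mul_coef b c n) // leq_subr.
rewrite mulrA coefM; apply: eq_bigr => i _.
have lein : (i <= n)%N by rewrite -ltnS.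
by rewrite -PE ?leq_subr // (@fps_mul_coef a b n).
Qed.

Lemma fps_mulC a b n : fps_mul a b n = fps_mul b a n.
Proof. by rewrite !(@fps_mul_coef _ _ n) // mulrC. Qed.

End FormalPowerSeries.

Section Bernoulli.
Variable R : numFieldType.

(* e^(xt) as a series in t over {poly R}, with x the indeterminate. *)
Definition fps_exp_xt (n : nat) : {poly R} := n`!%:R^-1 *: 'X^n.

(* (e^t - 1) / t; its constant coefficient is 1. *)
Definition fps_expm1_div_t (n : nat) : {poly R} := (n.+1`!%:R^-1)%:P.

(* t e^(xt) / (e^t - 1) = \sum_n B_n(x) t^n / n!, with the quotient computed
   as e^(xt) / ((e^t - 1) / t). *)
Definition bernoulli_poly (n : nat) : {poly R} :=
  n`!%:R *: fps_mul fps_exp_xt (fps_inv fps_expm1_div_t) n.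

(* The defining identity in the form
   (e^t - 1) * (\sum_n B_n(x) t^n / n!) = t e^(xt). *)
Lemma bernoulli_poly_gen (n : nat) :
  fps_mul (fun m => if m is 0 then 0 else (m`!%:R^-1)%:P)
          (fun m => m`!%:R^-1 *: bernoulli_poly m) n
  = if n is m.+1 then fps_exp_xt m else 0.
Proof.
have nzf m : m`!%:R != 0 :> R by rewrite pnatr_eq0 -lt0n fact_gt0.
rewrite /fps_mul big_ord_recl mul0r add0r.
case: n => [|n]; first by rewrite big_ord0.
transitivity (fps_mul fps_expm1_div_t
  (fps_mul (fps_inv fps_expm1_div_t) fps_exp_xt) n).
  apply: eq_bigr => i _; congr (_ * _).
  by rewrite /bernoulli_poly scalerA mulVf // scale1r fps_mulC.
have u0 : fps_expm1_div_t 0 \is a GRing.unit.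
  by rewrite /fps_expm1_div_t factS fact0 muln1 invr1 unitr1.
rewrite fps_mulA {1}/fps_mul big_ord_recl big1 => [|i _].
  by rewrite fps_mulV // mul1r addr0 subn0.
by rewrite fps_mulV // mul0r.
Qed.

End Bernoulli.

(* zeta(a_1, ..., a_r), the sum over 0 < k_1 < ... < k_r in the order
   convention of increasing indices.  The terms are nonnegative, so the sum is
   an unconditional one in \bar R; it is +oo exactly when the series diverges. *)
Definition mzv (R : realType) (r : nat) (a : 'I_r -> nat) : \bar R :=
  (\esum_(k in [set k : r.-tuple nat | path ltn 0%N k])
    (\prod_(i < r) (tnth k i)%:R ^- a i)%:E)%E.

(* Main.v *)
(* Put x_j = j^-4.  For finitely many j <= N, E(4n, k) is the coefficient of
   t^n y^k in prod_j (1 + y x_j t / (1 - x_j t)), which equals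
   prod_j (1 + (y - 1) x_j t) / prod_j (1 - x_j t); hence the elementary
   symmetric functions e_m of the x_j satisfy
     sum_i (-1)^i e_i E(4(p - i), k) = (-1)^(p - k) binom(p, k) e_p.
   As N grows, e_m tends to c_m = 2^(2m+1) pi^(4m) / (4m+2)!, so E(4p, k)
   converges too, to the product of the inverse series of sum (-1)^m c_m t^m
   with the right-hand side.  With t = z^4 that series is
   (sin(pi z) / (pi z)) (sinh(pi z) / (pi z)), whose inverse is expressed by the
   values B_m(1/2).  The limit of e_m follows from Cauchy's bounds
   cot^2 x < x^-2 < 1 + cot^2 x at x = j pi / (2N + 1), where the symmetric
   functions of cot^2 x are read off the expansion of sin((2N + 1) x). *)

Require Import Defs.
From HB Require Import structures.
From mathcomp Require Import all_boot all_order all_algebra.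
From mathcomp Require Import all_classical all_reals all_analysis.
From mathcomp Require Import ring lra zify.
From mathcomp Require Import complex.

Set Implicit Arguments.
Unset Strict Implicit.
Unset Printing Implicit Defensive.

Import Order.TTheory GRing.Theory Num.Theory.
Import numFieldNormedType.Exports.

Local Open Scope ring_scope.

(** * Elementary symmetric functions *)

Lemma natr_fact_neq0 (F : numDomainType) n : n`!%:R != 0 :> F.
Proof. by rewrite pnatr_eq0 -lt0n fact_gt0. Qed.

Lemma natr_bin_fact (F : numFieldType) a b :
  'C(a + b, a)%:R = (a + b)`!%:R / (a`!%:R * b`!%:R) :> F.
Proof.
by rewrite -(bin_fact (leq_addr b a)) addKn !natrM mulfK //
  mulf_neq0 ?natr_fact_neq0.
Qed.

Lemma coef_polyCDX_exp (R : comNzRingType) (c : R) n i :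
  ((c%:P + 'X) ^+ n)`_i = c ^+ (n - i) *+ 'C(n, i).
Proof.
rewrite exprDn coef_sum.
under eq_bigr => j _ do rewrite coefMn -polyC_exp mul_polyC coefZ coefXn.
have [lein|ltni] := leqP i n.
  rewrite (bigD1 (Ordinal (lein : i < n.+1)%N)) //= eqxx mulr1.
  rewrite big1 ?addr0 // => j; rewrite -val_eqE eq_sym /= => /negPf->.
  by rewrite mulr0 mul0rn.
rewrite bin_small // big1 // => j _.
by rewrite gtn_eqF ?mulr0 ?mul0rn // (leq_ltn_trans _ ltni) // -ltnS.
Qed.

Lemma prodrD_set (R : comNzRingType) (I : finType) (F G : I -> R) :
  \prod_i (F i + G i) =
  \sum_(A : {set I}) (\prod_(i in A) F i) * \prod_(i in ~: A) G i.
Proof.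
rewrite bigA_distr; apply: eq_bigr => A _; rewrite (bigID (mem A)) /=.
congr (_ * _); first by apply: eq_bigr => i ->.
by apply: eq_big => [i|i /negPf->]; rewrite ?inE.
Qed.

Definition esym_poly (R : comNzRingType) (x : nat -> R) (N : nat) : {poly R} :=
  \prod_(j < N) (1 + x j *: 'X).

Lemma coef_esym_poly (R : comNzRingType) (x : nat -> R) N m :
  (esym_poly x N)`_m = \sum_(A : {set 'I_N} | #|A| == m) \prod_(j in A) x j.
Proof.
have -> : esym_poly x N =
    \sum_(A : {set 'I_N}) (\prod_(j in A) x j) *: 'X^#|A|.
  rewrite /esym_poly (eq_bigr (fun j : 'I_N => x j *: 'X + 1)); last first.
    by move=> j _; rewrite addrC.
  rewrite prodrD_set; apply: eq_bigr => A _.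
  by rewrite big1_eq mulr1 scaler_prod prodr_const.
rewrite coef_sum [RHS]big_mkcond; apply: eq_bigr => A _.
by rewrite coefZ coefXn eq_sym; case: eqP; rewrite ?mulr1 ?mulr0.
Qed.

Lemma esym_poly0 (R : comNzRingType) (x : nat -> R) N : (esym_poly x N)`_0 = 1.
Proof.
rewrite -horner_coef0 horner_prod big1 // => j _.
by rewrite hornerD hornerZ hornerX mulr0 addr0 hornerC.
Qed.

Lemma size_esym_poly (R : comNzRingType) (x : nat -> R) N :
  (size (esym_poly x N) <= N.+1)%N.
Proof.
apply/leq_sizeP => j ltNj; rewrite coef_esym_poly big_pred0 // => A.
apply/eqP => cA; have := max_card (mem A); rewrite card_ord cA.
by rewrite leqNgt ltNj.
Qed.

Lemma esym_polyZ (R : comNzRingType) (c : R) (x : nat -> R) N m :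
  (esym_poly (fun j => c * x j) N)`_m = c ^+ m * (esym_poly x N)`_m.
Proof.
rewrite !coef_esym_poly mulr_sumr; apply: eq_bigr => A /eqP <-.
by rewrite big_split prodr_const.
Qed.

Lemma le_esym_poly (R : numDomainType) (x y : nat -> R) N m :
  (forall j, (j < N)%N -> 0 <= x j <= y j) ->
  (esym_poly x N)`_m <= (esym_poly y N)`_m.
Proof.
move=> xy; rewrite !coef_esym_poly; apply: ler_sum => A _.
by apply: ler_prod => j _; exact: xy.
Qed.

(** Compare coefficients of X^(2m) in prod (1 - x_j^2 X^2) = prod (1 - x_j X) * prod (1 + x_j X).
    This passes from exponent -2 to exponent -4. *)
Lemma esym_poly_sqr (R : comNzRingType) (x : nat -> R) N m :
  (-1) ^+ m * (esym_poly (fun j => x j ^+ 2) N)`_m =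
  \sum_(i < (2 * m).+1)
    (-1) ^+ i * (esym_poly x N)`_i * (esym_poly x N)`_(2 * m - i).
Proof.
rewrite -esym_polyZ.
transitivity ((esym_poly (fun j => -1 * x j ^+ 2) N \Po 'X^2)`_(2 * m)).
  by rewrite coef_comp_poly_Xn // dvdn_mulr // mulKn.
have -> : esym_poly (fun j => -1 * x j ^+ 2) N \Po 'X^2 =
          esym_poly (fun j => -1 * x j) N * esym_poly x N.
  rewrite /esym_poly rmorph_prod -big_split; apply: eq_bigr => j _ /=.
  rewrite comp_polyD comp_polyC comp_polyZ comp_polyX -!mul_polyC.
  rewrite !polyCM polyCN; ring.
by rewrite coefM; apply: eq_bigr => i _; rewrite esym_polyZ.
Qed.

(** Each factor is x_j X + (1 + X); choosing x_j X on a set A leaves (1 + X)^(N - #|A|). It turns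
    cot^2 into 1 + cot^2 in the upper bound. *)
Lemma esym_poly_add1 (R : comNzRingType) (x : nat -> R) N m :
  (esym_poly (fun j => 1 + x j) N)`_m =
  \sum_(i < m.+1) (esym_poly x N)`_i * 'C(N - i, m - i)%:R.
Proof.
transitivity ((\sum_(A : {set 'I_N})
    (\prod_(j in A) x j) *: ('X^#|A| * (1 + 'X) ^+ (N - #|A|)) : {poly R})`_m).
  congr ((_ : {poly R})`_m); rewrite /esym_poly.
  rewrite (eq_bigr (fun j : 'I_N => x j *: 'X + (1 + 'X))); last first.
    by move=> j _; rewrite scalerDl scale1r; ring.
  rewrite prodrD_set; apply: eq_bigr => A _.
  by rewrite scaler_prod !prodr_const scalerAl (cardsCs (~: A))
    finset.setCK card_ord.
rewrite coef_sum.
transitivity (\sum_(A : {set 'I_N} | (#|A| <= m)%N)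
   (\prod_(j in A) x j) * 'C(N - #|A|, m - #|A|)%:R).
  rewrite [RHS]big_mkcond; apply: eq_bigr => A _.
  rewrite coefZ coefXnM ltnNge; case: leqP => //= _; last by rewrite mulr0.
  by rewrite coef_polyCDX_exp expr1n.
rewrite (partition_big (fun A : {set 'I_N} => inord #|A| : 'I_m.+1) xpredT) //=.
apply: eq_bigr => i _; rewrite coef_esym_poly mulr_suml.
apply: eq_big => [A|A]; last by case/andP => lA /eqP <-; rewrite inordK.
apply/andP/eqP => [[lA /eqP <-]|->]; first by rewrite inordK.
by rewrite -ltnS ltn_ord inord_val eqxx.
Qed.

(** * A truncated generating function *)

(** The variable is specialised in another ring so that [u] can be the bivariate X (Y - 1). *)
Lemma prod_rmorph_esym_poly (R S : comNzRingType) (c : {rmorphism R -> S})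
    (u : S) (x : nat -> R) N :
  \prod_(j < N) (1 + c (x j) * u) =
  \sum_(m < N.+1) c (esym_poly x N)`_m * u ^+ m.
Proof.
transitivity ((map_poly c (esym_poly x N)).[u]); last first.
  rewrite (@horner_coef_wide _ N.+1); last first.
    exact: leq_trans (size_poly _ _) (size_esym_poly _ _).
  by apply: eq_bigr => m _; rewrite coef_map.
rewrite rmorph_prod horner_prod; apply: eq_bigr => j _ /=.
by rewrite rmorphD rmorph1 /= map_polyZ /= map_polyX !hornerE.
Qed.

(** The series x t / (1 - x t) cut at degree n, which keeps the generating function a polynomial. *)
Definition geom_trunc (R : comNzRingType) (n : nat) (x : R) : {poly R} :=
  \sum_(a < n.+1 | (0 < a)%N) x ^+ a *: 'X^a.

Lemma geom_truncE (R : comNzRingType) n (x : R) :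
  (1 - x *: 'X) * geom_trunc n x = x *: 'X - (x *: 'X) ^+ n.+1.
Proof.
rewrite /geom_trunc; under eq_bigr do rewrite -exprZn.
elim: n => [|n IHn]; first by rewrite big_mkcond big_ord1 mulr0 subrr.
by rewrite big_mkcond big_ord_recr -big_mkcond /= mulrDr IHn !exprS; ring.
Qed.

(** A congruence modulo z with explicit witness: truncation errors divisible by X^(n+1) in each
    factor stay so in the product. *)
Lemma prod_addM_dvd (R : comNzRingType) (I : Type) (r : seq I) (z : R)
    (F G : I -> R) :
  exists w, \prod_(i <- r) (F i + z * G i) = \prod_(i <- r) F i + z * w.
Proof.
elim: r => [|i r [w IHr]]; first by exists 0; rewrite !big_nil mulr0 addr0.
exists (F i * w + G i * (\prod_(j <- r) F j + z * w)).
by rewrite !big_cons IHr; ring.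
Qed.

Lemma esym_poly_geom_trunc (R : comNzRingType) (x : nat -> R) N n k p :
  (p <= n)%N ->
  \sum_(i < p.+1) (-1) ^+ i * (esym_poly x N)`_i *
     ((esym_poly (fun j => geom_trunc n (x j)) N)`_k)`_(p - i) =
  (-1) ^+ (p - k) * 'C(p, k)%:R * (esym_poly x N)`_p.
Proof.
move=> lepn; set W := esym_poly (fun j => geom_trunc n (x j)) N.
pose c : {rmorphism R -> {poly {poly R}}} := polyC \o polyC.
(* Modulo X^(n+1), (1 - x_j X) (1 + Y geom_trunc n x_j) is
   1 + x_j X (Y - 1); the outer variable is Y. *)
have [V E] : exists V : {poly {poly R}},
    (esym_poly (fun j => -1 * x j) N)%:P * W =
    \prod_(j < N) (1 + c (x j) * ('X%:P * ((-1)%:P + 'X))) + ('X^(n.+1))%:P * V.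
  rewrite /W /esym_poly rmorph_prod -big_split.
  have [V EV] := prod_addM_dvd (index_enum 'I_N) (('X^(n.+1))%:P)
    (fun j => 1 + c (x j) * ('X%:P * ((-1)%:P + 'X)))
    (fun j => - ((x j ^+ n.+1)%:P)%:P * 'X).
  exists V; apply: etrans EV; apply: eq_bigr => j _ /=.
  have := geom_truncE n (x j); set f := geom_trunc _ _ => Ef.
  transitivity (1 - (x j *: 'X)%:P + ((1 - x j *: 'X) * f)%:P * 'X).
    rewrite mulN1r scaleNr -[f *: 'X]mul_polyC !rmorphM !rmorphD !rmorph1 /=.
    by rewrite !rmorphN /=; ring.
  rewrite Ef exprZn -!mul_polyC !polyCB !polyCM polyCN; ring.
have := congr1 (fun P : {poly {poly R}} => (P`_k)`_p) E.
rewrite coefCM coefM coefD coefCM coefD coefXnM ltnS lepn addr0.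
under eq_bigr do rewrite esym_polyZ.
move->; rewrite prod_rmorph_esym_poly !coef_sum.
(* The power X^m selects m = p, and Y^k in (Y - 1)^m gives the sign and the binomial. *)
have coefT a m : ((c a * ('X%:P * ((-1)%:P + 'X)) ^+ m)`_k)`_p =
    if m == p then (-1) ^+ (m - k) * 'C(m, k)%:R * a else 0.
  rewrite exprMn -polyC_exp mulrA -polyCM coefCM -polyCN.
  rewrite coef_polyCDX_exp -polyC_exp -polyCMn -mulrA coefCM.
  rewrite coefMC coefXn eq_sym.
  rewrite -[_ *+ 'C(_, _)]mulr_natr.
  by case: eqP => _; rewrite ?mul1r ?mul0r ?mulr0 ?(mulrC a).
under eq_bigr do rewrite coefT.
rewrite -big_mkcond.
(* When p > N no summand has m = p, and e_p is zero as well. *)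
have [lepN|ltNp] := leqP p N.
  by rewrite (big_pred1 (Ordinal (lepN : p < N.+1)%N)).
rewrite big_pred0 => [|m]; last by rewrite ltn_eqF // (leq_trans (ltn_ord m)).
by rewrite nth_default ?mulr0 // (leq_trans (size_esym_poly _ _)).
Qed.

(** * Odd multiples of the angle *)

Lemma sum_ord_pairs (V : nmodType) (F : nat -> V) M :
  \sum_(i < (2 * M)%N) F i = \sum_(j < M) (F (2 * j)%N + F (2 * j).+1).
Proof.
elim: M => [|M IHM]; first by rewrite !big_ord0.
by rewrite mulnS !big_ord_recr IHM /= addrA.
Qed.

Local Open Scope complex_scope.

(** The odd terms of the binomial expansion carry i^(2j+1) = (-1)^j i. The range M is free because
    the binomials vanish beyond n. *)
Lemma Im_exp (R : rcfType) (c s : R) n M : (n < 2 * M)%N ->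
  complex.Im ((c +i* s) ^+ n) =
  \sum_(j < M)
    (-1) ^+ j * 'C(n, (2 * j).+1)%:R * c ^+ (n - (2 * j).+1) * s ^+ (2 * j).+1.
Proof.
move=> ltnM.
have -> : c +i* s = c%:C + s%:C * 'i.
  by apply/eqP; rewrite eq_complex /=; apply/andP; split; apply/eqP; ring.
pose F i := (c%:C ^+ (n - i) * (s%:C * 'i) ^+ i) *+ 'C(n, i).
have -> : (c%:C + s%:C * 'i) ^+ n = \sum_(i < (2 * M)%N) F i.
  rewrite exprDn (big_ord_widen _ F ltnM).
  rewrite [RHS](bigID (fun i : 'I__ => i < n.+1)%N) /=.
  rewrite [X in _ + X]big1 ?addr0 // => i; rewrite -leqNgt => ltni.
  by rewrite /F bin_small.
have sqri : 'i * 'i = (-1)%:C :> R[i].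
  by apply/eqP; rewrite eq_complex /=; apply/andP; split; apply/eqP; ring.
have iX j : 'i ^+ (2 * j) = ((-1) ^+ j)%:C :> R[i].
  by rewrite exprM expr2 sqri rmorphXn.
have FE i : F i = ('C(n, i)%:R * c ^+ (n - i) * s ^+ i)%:C * 'i ^+ i.
  rewrite /F exprMn -mulr_natr !rmorphM !rmorphXn rmorph_nat /=; ring.
have E2 j : F (2 * j)%N = ((-1) ^+ j *
    ('C(n, 2 * j)%:R * c ^+ (n - 2 * j) * s ^+ (2 * j)))%:C.
  by rewrite FE iX -rmorphM mulrC.
have E1 j : F (2 * j).+1 = ((-1) ^+ j * ('C(n, (2 * j).+1)%:R *
    c ^+ (n - (2 * j).+1) * s ^+ (2 * j).+1))%:C * 'i.
  by rewrite FE (exprSr 'i) iX mulrA -rmorphM [X in X%:C%C]mulrC.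
rewrite sum_ord_pairs raddf_sum; apply: eq_bigr => j _ /=.
by rewrite E2 E1 /=; ring.
Qed.

Lemma de_moivre (R : realType) (x : R) n :
  (cos x +i* sin x) ^+ n = cos (n%:R * x) +i* sin (n%:R * x).
Proof.
elim: n => [|n IHn]; first by rewrite mul0r cos0 sin0.
rewrite exprS IHn -natr1 mulrDl mul1r cosD sinD.
by apply/eqP; rewrite eq_complex /=; apply/andP; split; apply/eqP; ring.
Qed.

(** Both sides are the imaginary part of (1 + i)^(4m+2) = (2i)^(2m+1). *)
Lemma sum_alt_bin_odd (R : rcfType) m :
  \sum_(j < (2 * m).+1) (-1) ^+ j * 'C(4 * m + 2, (2 * j).+1)%:R =
  (-1) ^+ m * 2 ^+ (2 * m + 1) :> R.
Proof.
(* The strict bound n < 2M requires one term more than the sum has; its binomial is zero. *)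
have := @Im_exp R 1 1 (4 * m + 2) (2 * m).+2.
rewrite big_ord_recr /= [in 'C(_, (2 * (2 * m).+1).+1)]bin_small; last by lia.
rewrite mulr0 !mul0r addr0.
under eq_bigr do rewrite !expr1n !mulr1.
move<-; last by lia.
rewrite (_ : (4 * m + 2 = 2 * (2 * m + 1))%N); last by lia.
have iE : (1 +i* 1) ^+ 2 = 2%:C * 'i :> R[i].
  rewrite expr2.
  by apply/eqP; rewrite eq_complex /=; apply/andP; split; apply/eqP; ring.
have sqri : 'i ^+ 2 = (-1)%:C :> R[i].
  rewrite expr2.
  by apply/eqP; rewrite eq_complex /=; apply/andP; split; apply/eqP; ring.
rewrite exprM iE exprMn [in X in _ * X]addn1 exprSr exprM sqri.
have XC (a : R) k : a%:C ^+ k = (a ^+ k)%:C by rewrite rmorphXn.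
by rewrite !XC /=; ring.
Qed.

Local Close Scope complex_scope.

Lemma sin_odd_mul (R : realType) (x : R) N : cos x != 0 ->
  sin ((2 * N).+1%:R * x) = sin x * cos x ^+ (2 * N) *
    \sum_(j < N.+1) 'C((2 * N).+1, (2 * j).+1)%:R * (- tan x ^+ 2) ^+ j.
Proof.
move=> cx; have := @Im_exp R (cos x) (sin x) (2 * N).+1 N.+1.
rewrite de_moivre /= => ->; last by lia.
rewrite mulr_sumr; apply: eq_bigr => j _.
have -> : cos x ^+ (2 * N) = cos x ^+ (2 * N - 2 * j) * cos x ^+ (2 * j).
  by rewrite -exprD subnK // leq_pmul2l // -ltnS.
have -> : (- tan x ^+ 2) ^+ j =
    (-1) ^+ j * (sin x ^+ (2 * j) / cos x ^+ (2 * j)).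
  by rewrite [LHS]exprNn -exprM exprMn exprVn.
rewrite subSS exprS; set u := cos x ^+ (2 * j); set v := sin x ^+ (2 * j).
by field; rewrite expf_neq0.
Qed.

(** * Bounds for the squared cotangents *)

Section Cotangent.
Variable R : realType.
Implicit Type x : R.

Lemma sin_le_id x : 0 <= x -> sin x <= x.
Proof.
move=> x0; rewrite -subr_ge0.
have -> : 0 = 0 - sin 0 :> R by rewrite sin0 subrr.
have D (y : R) : is_derive y (1 : R) (fun y : R => y - sin y) (1 - cos y).
  by apply: is_derive_eq.
apply: (@ger0_derive1_ndecry R (fun y => y - sin y) 0) => //.
- by move=> y _; rewrite derive1E derive_val subr_ge0 cos_le1.
- apply: continuous_subspaceT => y.
  by apply: differentiable_continuous; apply/derivable1_diffP.
Qed.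

(** The difference has derivative y sin y, nonnegative on [0, pi]. Below pi/2 this yields x <= tan
    x, hence cot^2 x <= x^-2. *)
Lemma mul_cos_le_sin x : 0 <= x <= pi -> x * cos x <= sin x.
Proof.
move=> /andP[x0 xpi]; rewrite -subr_ge0.
have -> : 0 = sin 0 - 0 * cos 0 :> R by rewrite sin0 mul0r subrr.
have D (y : R) : is_derive y (1 : R) (fun y : R => sin y - y * cos y)
    (y * sin y).
  apply: is_derive_eq; rewrite /= !scaler1 /GRing.scale /=; ring.
apply: (@ger0_derive1_ndecr R (fun y => sin y - y * cos y) 0 pi) => //.
- move=> y; rewrite in_itv /= => /andP[y0 ypi].
  by rewrite derive1E derive_val mulr_ge0 ?sin_ge0_pi // ltW //= ltW.
- apply: continuous_subspaceT => y.
  by apply: differentiable_continuous; apply/derivable1_diffP.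
Qed.

(** For k < N these are the zeros of sin((2N+1)x) in ]0, pi/2[, indexed from 0. *)
Definition theta N k : R := k.+1%:R * pi / (2 * N).+1%:R.

Lemma theta_itv N k : (k < N)%N -> 0 < theta N k < pi / 2.
Proof.
move=> ltkN; rewrite /theta !mulr_gt0 ?pi_gt0 ?invr_gt0 ?ltr0n //=.
rewrite ltr_pdivrMr ?ltr0n // mulrAC [X in _ < X]mulrC mulrA -subr_gt0.
rewrite (_ : _ - _ = ((2 * N).+1%:R / 2 - k.+1%:R) * pi); last by field.
rewrite mulr_gt0 ?pi_gt0 // subr_gt0 ltr_pdivlMr // -natrM ltr_nat; lia.
Qed.

Lemma theta_inj N : injective (theta N).
Proof.
move=> i j /(mulIf (invr_neq0 (lt0r_neq0 (ltr0Sn R _)))).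
move=> /(mulIf (lt0r_neq0 (pi_gt0 R))) /eqP.
by rewrite eqr_nat eqSS => /eqP.
Qed.

Lemma sin_theta_gt0 N k : (k < N)%N -> 0 < sin (theta N k).
Proof. by move/theta_itv; exact: sin_gt0_pihalf. Qed.

Lemma cos_theta_gt0 N k : (k < N)%N -> 0 < cos (theta N k).
Proof.
move/theta_itv => /andP[t0 tpi]; apply: cos_gt0_pihalf.
by rewrite tpi (lt_trans _ t0) // oppr_lt0 divr_gt0 ?pi_gt0.
Qed.

Lemma tan_theta_gt0 N k : (k < N)%N -> 0 < tan (theta N k).
Proof. by move=> kN; rewrite divr_gt0 ?sin_theta_gt0 ?cos_theta_gt0. Qed.

Lemma tan_theta_inj N :
  {in [pred k | k < N]%N &, injective (fun k => tan (theta N k))}.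
Proof.
have thetaI k : (k < N)%N -> theta N k \in `](- (pi / 2)), (pi / 2)[.
  move/theta_itv => /andP[t0 tpi]; rewrite in_itv /= tpi andbT.
  by rewrite (lt_trans _ t0) // oppr_lt0 divr_gt0 ?pi_gt0.
by move=> i j iN jN /(tan_inj (thetaI _ iN) (thetaI _ jN)); exact: theta_inj.
Qed.

(* sin ((2N+1) x) = sin x * cos^(2N) x * (tan_poly N).[- tan^2 x]. *)
Definition tan_poly N : {poly R} :=
  \poly_(j < N.+1) 'C((2 * N).+1, (2 * j).+1)%:R.

Lemma root_tan_poly N k :
  (k < N)%N -> root (tan_poly N) (- tan (theta N k) ^+ 2).
Proof.
move=> kN; have cN0 := lt0r_neq0 (cos_theta_gt0 kN).
have := sin_odd_mul N cN0.
rewrite mulrC divfK ?pnatr_eq0 // mulr_natl -[pi *+ _]add0r.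
rewrite (alternatingn (@sinDpi R)) sin0 mulr0 => /esym/eqP.
rewrite !mulf_eq0 expf_eq0 (negPf cN0) andbF orbF.
by rewrite (gt_eqF (sin_theta_gt0 kN)) /= rootE horner_poly.
Qed.

(** A polynomial of degree N with N distinct known roots is determined up to a scalar. *)
Lemma tan_polyE N : tan_poly N =
  (2 * N).+1%:R *: esym_poly (fun k => (tan (theta N k)) ^- 2) N.
Proof.
pose rs := [seq - tan (theta N k) ^+ 2 | k <- iota 0 N].
have lc : 'C((2 * N).+1, (2 * N).+1)%:R != 0 :> R by rewrite binn oner_neq0.
have sz : size (tan_poly N) = (size rs).+1.
  by rewrite size_map size_iota size_poly_eq.
have rt : all (root (tan_poly N)) rs.
  apply/allP => _ /mapP[k + ->]; rewrite mem_iota add0n /= => kN.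
  exact: root_tan_poly.
have ur : uniq_roots rs.
  rewrite uniq_rootsE map_inj_in_uniq ?iota_uniq // => i j.
  rewrite !mem_iota !add0n /= => iN jN /oppr_inj /eqP.
  rewrite eqrXn2 ?ltW ?tan_theta_gt0 // => /eqP.
  exact: tan_theta_inj.
(* Taking tan^2 out of each factor X + tan^2 leaves 1 + cot^2 X. *)
pose a := \prod_(k < N) tan (theta N k) ^+ 2.
have E : tan_poly N = a *: esym_poly (fun k => (tan (theta N k)) ^- 2) N.
  rewrite (all_roots_prod_XsubC sz rt ur) lead_coef_poly // binn scale1r.
  rewrite big_map -[in iota 0 N](subn0 N) -/(index_iota 0 N) big_mkord.
  rewrite /esym_poly /a -scaler_prod; apply: eq_bigr => k _.
  rewrite rmorphN opprK scalerDr scalerA divff ?scale1r.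
    by rewrite addrC -[_ *: 1]mul_polyC mulr1.
  by rewrite expf_neq0 // gt_eqF // tan_theta_gt0.
rewrite E; congr (_ *: _).
(* The constant coefficients show that a = 2N + 1. *)
have := congr1 (fun p : {poly R} => p`_0) E.
by rewrite coefZ esym_poly0 mulr1 coef_poly /= muln0 bin1.
Qed.

Lemma esym_cot2 N m :
  (esym_poly (fun k => (tan (theta N k)) ^- 2) N)`_m =
  'C((2 * N).+1, (2 * m).+1)%:R / (2 * N).+1%:R.
Proof.
have := congr1 (fun p : {poly R} => p`_m) (tan_polyE N).
rewrite coefZ coef_poly => /(canLR (mulKf _)) <-; last by rewrite pnatr_eq0.
rewrite mulrC; case: ltnP => // ltNm; congr (_ / _).
by rewrite bin_small //; lia.
Qed.

Lemma esym_sandwich N m :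
  'C((2 * N).+1, (2 * m).+1)%:R / (2 * N).+1%:R <=
  (esym_poly (fun k => (theta N k) ^- 2) N)`_m <=
  \sum_(i < m.+1) 'C((2 * N).+1, (2 * i).+1)%:R / (2 * N).+1%:R
     * 'C(N - i, m - i)%:R.
Proof.
apply/andP; split.
  rewrite -esym_cot2; apply: le_esym_poly => k kN.
  have /andP[t0 tpi] := theta_itv kN.
  rewrite invr_ge0 exprn_ge0 ?(ltW (tan_theta_gt0 _)) //=.
  rewrite lef_pV2 ?posrE ?exprn_gt0 ?tan_theta_gt0 //.
  rewrite lerXn2r ?nnegrE ?(ltW t0) ?(ltW (tan_theta_gt0 _)) //.
  rewrite ler_pdivlMr ?cos_theta_gt0 // mul_cos_le_sin // (ltW t0) /=.
  by have := pi_ge0 R; lra.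
under eq_bigr do rewrite -esym_cot2.
rewrite -esym_poly_add1; apply: le_esym_poly => k kN.
have /andP[t0 tpi] := theta_itv kN.
rewrite invr_ge0 exprn_ge0 ?(ltW t0) //=.
have -> : 1 + tan (theta N k) ^- 2 = sin (theta N k) ^- 2.
  have c0 := lt0r_neq0 (cos_theta_gt0 kN).
  have s0 := lt0r_neq0 (sin_theta_gt0 kN).
  rewrite /tan -[sin _ ^- 2]mul1r -[X in _ = X * _](cos2Dsin2 (theta N k)).
  by field; rewrite c0 s0.
rewrite lef_pV2 ?posrE ?exprn_gt0 ?sin_theta_gt0 //.
by rewrite lerXn2r ?nnegrE ?(ltW t0) ?(ltW (sin_theta_gt0 _)) ?sin_le_id ?ltW.
Qed.

End Cotangent.

(** * Limits of elementary symmetric functions *)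

Local Open Scope classical_set_scope.

Lemma cvgr_sum (R : realType) (I : Type) (r : seq I) (P : pred I)
    (u : I -> R ^nat) (l : I -> R) :
  (forall i, P i -> u i @ \oo --> l i) ->
  (fun N => \sum_(i <- r | P i) u i N) @ \oo --> \sum_(i <- r | P i) l i.
Proof.
move=> cu; elim: r => [|i r IHr].
  by rewrite big_nil; under eq_fun do rewrite big_nil; exact: cvg_cst.
rewrite big_cons; under eq_fun do rewrite big_cons.
by case: ifPn => // /cu cui; exact: cvgD.
Qed.

Section ZetaTwos.
Variable R : realType.

(** Induction on r through (r+1) C(n+1, r+1) = (n+1-r) C(n+1, r). *)
Lemma cvg_binX r :
  (fun n => 'C(n.+1, r)%:R / n.+1%:R ^+ r : R) @ \oo --> (r`!%:R^-1 : R).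
Proof.
elim: r => [|r IHr].
  have -> : (fun n => 'C(n.+1, 0)%:R / n.+1%:R ^+ 0) = cst (1 : R).
    by apply/funext => n; rewrite bin0 expr0 divr1.
  by rewrite fact0 invr1; exact: cvg_cst.
have cF : (fun n => (n.+1 - r)%:R / n.+1%:R : R) @ \oo --> (1 : R).
  have : (fun n => 1 - r%:R * harmonic n : R) @ \oo --> (1 - r%:R * 0 : R).
    apply: cvgB; first exact: cvg_cst.
    by apply: cvgM; [exact: cvg_cst|exact: cvg_harmonic].
  rewrite mulr0 subr0; apply: cvg_trans; apply: near_eq_cvg.
  near=> n; have rn : (r <= n)%N by near: n; exists r.
  rewrite natrB ?mulrBl ?divff ?pnatr_eq0 //; exact: leqW.
have -> : r.+1`!%:R^-1 = r`!%:R^-1 * 1 * r.+1%:R^-1 :> R.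
  by rewrite mulr1 -invfM -natrM mulnC -factS.
have : (fun n => 'C(n.+1, r)%:R / n.+1%:R ^+ r *
    ((n.+1 - r)%:R / n.+1%:R) * r.+1%:R^-1 : R) @ \oo -->
    (r`!%:R^-1 * 1 * r.+1%:R^-1 : R).
  by apply: cvgM; [exact: cvgM|exact: cvg_cst].
apply: cvg_trans; apply: near_eq_cvg; near=> n => /=.
have /(congr1 (fun m => m%:R : R)) := mul_bin_left n.+1 r.
rewrite !natrM => E; apply: (@mulfI _ r.+1%:R); first by rewrite pnatr_eq0.
rewrite [RHS]mulrA E exprS.
have b0 : n.+1%:R != 0 :> R by rewrite pnatr_eq0.
have r0 : r.+1%:R != 0 :> R by rewrite pnatr_eq0.
move: b0 r0; set b : R := n.+1%:R; set d : R := r.+1%:R => b0 r0.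
clearbody b d.
by field; rewrite expf_neq0 ?b0.
Unshelve. all: by end_near. Qed.

Lemma leq_bin_exp n d : ('C(n, d) <= n ^ d)%N.
Proof.
apply: (@leq_trans (n ^_ d)); first by rewrite -bin_ffact leq_pmulr ?fact_gt0.
elim: d => // d IHd; rewrite ffactnSr expnSr; apply: leq_mul => //.
exact: leq_subr.
Qed.

(** A binomial of order N^d is divided by one of order N^(2d). Hence only the top term of the upper
    bound survives in the limit. *)
Lemma cvg_bin_small i d :
  (fun N => 'C(N - i, d)%:R / (2 * N).+1%:R ^+ (2 * d) : R) @ \oo -->
  ((d == 0)%:R : R).
Proof.
case: d => [|d] /=.
  rewrite (_ : (fun _ => _) = cst 1); first exact: cvg_cst.
  by apply/funext => N; rewrite bin0 muln0 expr0 divr1.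
apply: (@squeeze_cvgr _ _ _ _ (cst 0) (@harmonic R)).
- near=> N; apply/andP; split; first by rewrite divr_ge0 // exprn_ge0.
  rewrite ler_pdivrMr ?exprn_gt0 ?ltr0n // -natrX /harmonic mulrC.
  rewrite ler_pdivlMr ?ltr0n // -natrM ler_nat.
  rewrite (leq_trans (leq_mul (leq_bin_exp _ _) (leqnn _))) //.
  (* One copy of (2N+1)^(d+1) bounds (N-i)^(d+1), the other bounds N + 1. *)
  have -> : (2 * d.+1 = d.+1 + d.+1)%N by lia.
  rewrite expnD leq_mul ?leq_exp2r //; first by lia.
  by apply: (@leq_trans ((2 * N).+1 ^ 1)); rewrite ?leq_pexp2l ?expn1 //; lia.
- exact: cvg_cst.
- exact: cvg_harmonic.
Unshelve. all: by end_near. Qed.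

Lemma cvg_binX_odd r :
  (fun N => 'C((2 * N).+1, r)%:R / (2 * N).+1%:R ^+ r : R) @ \oo -->
  (r`!%:R^-1 : R).
Proof. exact: (cvg_comp _ _ (@cvg_mulnl 2 isT) (@cvg_binX r)). Qed.

(** The limit is zeta(2, ..., 2). Rescaling [esym_sandwich] by ((2N+1)/pi)^(2m) gives the bounds
    [lo] and [hi], which share this limit. *)
Lemma cvg_esym_sq m :
  (fun N => (esym_poly (fun k => k.+1%:R ^- 2 : R) N)`_m) @ \oo -->
  (pi ^+ (2 * m) / (2 * m).+1`!%:R : R).
Proof.
have thetaE N k : theta R N k ^- 2 = ((2 * N).+1%:R / pi) ^+ 2 * k.+1%:R ^- 2.
  rewrite /theta -!exprVn -exprMn !invfM invrK; congr (_ ^+ 2); ring.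
have piN0 : pi != 0 :> R by rewrite lt0r_neq0 ?pi_gt0.
pose lo N : R := pi ^+ (2 * m) * ('C((2 * N).+1, (2 * m).+1)%:R /
   (2 * N).+1%:R ^+ (2 * m).+1).
pose hi N : R := \sum_(i < m.+1) pi ^+ (2 * m) *
   ('C((2 * N).+1, (2 * i).+1)%:R / (2 * N).+1%:R ^+ (2 * i).+1) *
   ('C(N - i, m - i)%:R / (2 * N).+1%:R ^+ (2 * (m - i))).
apply: (@squeeze_cvgr _ _ _ _ lo hi).
- near=> N; have := esym_sandwich R N m.
  have -> : (esym_poly (fun k => theta R N k ^- 2) N)`_m =
     ((2 * N).+1%:R / pi) ^+ (2 * m) *
     (esym_poly (fun k => k.+1%:R ^- 2 : R) N)`_m.
    rewrite exprM -esym_polyZ; congr ((esym_poly _ N)`_m).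
    by apply/funext => k; rewrite thetaE.
  set e := (esym_poly _ _)`_m => /andP[lo_e e_hi].
  have X0 : (2 * N).+1%:R != 0 :> R by rewrite pnatr_eq0.
  have c0 : 0 < ((2 * N).+1%:R / pi : R) ^+ (2 * m).
    by rewrite exprn_gt0 // divr_gt0 ?pi_gt0.
  rewrite -(ler_pM2l c0) -(ler_pM2l c0 e).
  have -> : ((2 * N).+1%:R / pi) ^+ (2 * m) * lo N =
      'C((2 * N).+1, (2 * m).+1)%:R / (2 * N).+1%:R.
    rewrite /lo exprMn exprVn exprS; move: X0 piN0.
    move: ((2 * N).+1%:R : R) (pi : R) => X p X0 p0.
    by field; rewrite X0 !expf_neq0.
  rewrite lo_e (le_trans e_hi) // le_eqVlt; apply/orP; left; apply/eqP.
  rewrite /hi mulr_sumr; apply: eq_bigr => i _.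
  have -> : ((2 * N).+1%:R / pi : R) ^+ (2 * m) = (2 * N).+1%:R ^+ (2 * i) *
     (2 * N).+1%:R ^+ (2 * (m - i)) / pi ^+ (2 * m).
    by rewrite -exprD -mulnDr subnKC ?exprMn ?exprVn // -ltnS.
  rewrite exprS; move: X0 piN0; move: ((2 * N).+1%:R : R) (pi : R) => X p X0 p0.
  by field; rewrite X0 !expf_neq0.
- by apply: cvgM; [exact: cvg_cst|exact: cvg_binX_odd].
- rewrite [X in _ --> X](_ : _ = \sum_(i < m.+1) pi ^+ (2 * m) *
      (2 * i).+1`!%:R^-1 * ((m - i)%N == 0%N)%:R); last first.
    rewrite big_ord_recr /= subnn eqxx mulr1 big1 ?add0r // => i _ /=.
    by rewrite subn_eq0 leqNgt ltn_ord mulr0.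
  apply: cvgr_sum => i _; apply: cvgM; last exact: cvg_bin_small.
  by apply: cvgM; [exact: cvg_cst|exact: cvg_binX_odd].
Unshelve. all: by end_near. Qed.

(** By [esym_poly_sqr] the limit is an alternating convolution of the values zeta(2, ..., 2), which
    [sum_alt_bin_odd] evaluates. *)
Lemma cvg_esym_4 m :
  (fun N => (esym_poly (fun k => k.+1%:R ^- 4 : R) N)`_m) @ \oo -->
  (2 ^+ (2 * m + 1) * pi ^+ (4 * m) / (4 * m + 2)`!%:R : R).
Proof.
have -> : (fun N => (esym_poly (fun k => k.+1%:R ^- 4 : R) N)`_m) =
  (fun N => \sum_(i < (2 * m).+1) (-1) ^+ m *
    ((-1) ^+ i * (esym_poly (fun k => k.+1%:R ^- 2 : R) N)`_i *
     (esym_poly (fun k => k.+1%:R ^- 2 : R) N)`_(2 * m - i))).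
  apply/funext => N; rewrite -mulr_sumr -esym_poly_sqr mulrA -exprMn.
  rewrite mulrNN mulr1 expr1n mul1r; congr ((esym_poly _ N)`_m).
  by apply/funext => k; rewrite exprVn -exprM.
rewrite [X in _ --> X](_ : _ = \sum_(i < (2 * m).+1) (-1) ^+ m *
  ((-1) ^+ i * (pi ^+ (2 * i) / (2 * i).+1`!%:R) *
    (pi ^+ (2 * (2 * m - i)) / (2 * (2 * m - i)).+1`!%:R))); last first.
  have -> : 2 ^+ (2 * m + 1) = (-1) ^+ m * ((-1) ^+ m * 2 ^+ (2 * m + 1)) :> R.
    by rewrite mulrA -exprMn mulrNN mulr1 expr1n mul1r.
  rewrite -sum_alt_bin_odd mulr_sumr !mulr_suml; apply: eq_bigr => i _.
  have lei : (i <= 2 * m)%N by rewrite -ltnS.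
  have -> : (4 * m + 2 = (2 * i).+1 + (2 * (2 * m - i)).+1)%N by lia.
  have -> : (4 * m = 2 * i + 2 * (2 * m - i))%N by lia.
  rewrite exprD natr_bin_fact; set a := (2 * i)%N; set b := (2 * (2 * m - i))%N.
  move: (natr_fact_neq0 R a.+1) (natr_fact_neq0 R b.+1).
  move: (natr_fact_neq0 R (a.+1 + b.+1)).
  move: (a.+1`!%:R : R) (b.+1`!%:R : R) ((a.+1 + b.+1)`!%:R : R).
  move=> x y z z0 x0 y0.
  by field; rewrite x0 y0 z0.
apply: cvgr_sum => i _; apply: cvgM; first exact: cvg_cst.
apply: cvgM; last exact: cvg_esym_sq.
by apply: cvgM; [exact: cvg_cst|exact: cvg_esym_sq].
Qed.

End ZetaTwos.

(** * Bernoulli polynomials at one half *)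

Section FormalInverse.
Variable R : realType.

Lemma fps_mul_scale (A : comUnitRingType) (c : A) (a b : nat -> A) n :
  fps_mul (fun i => c ^+ i * a i) (fun i => c ^+ i * b i) n =
  c ^+ n * fps_mul a b n.
Proof.
rewrite /fps_mul mulr_sumr; apply: eq_bigr => i _.
have -> : c ^+ n = c ^+ i * c ^+ (n - i) by rewrite -exprD subnKC // -ltnS.
ring.
Qed.

Lemma eq_fps_mul (A : comUnitRingType) (a a' b b' : nat -> A) n :
  a =1 a' -> b =1 b' -> fps_mul a b n = fps_mul a' b' n.
Proof. by move=> aE bE; apply: eq_bigr => i _; rewrite aE bE. Qed.

Definition fps_exp (a : R) (n : nat) : R := a ^+ n / n`!%:R.

Lemma fps_expD a b n :
  fps_mul (fps_exp a) (fps_exp b) n = fps_exp (a + b) n.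
Proof.
rewrite /fps_exp addrC exprDn mulr_suml; apply: eq_bigr => i _.
have lein : (i <= n)%N by rewrite -ltnS.
have := @natr_bin_fact R i (n - i); rewrite subnKC // => binE.
rewrite -[_ *+ 'C(n, i)]mulr_natr binE.
move: (natr_fact_neq0 R i) (natr_fact_neq0 R (n - i)) (natr_fact_neq0 R n).
move: (_`!%:R : R) (_`!%:R : R) (_`!%:R : R) => x y z x0 y0 z0.
by field; rewrite x0 y0 z0.
Qed.

(** The coefficient of t^n in t e^(t/2) / (e^t - 1) = (t/2) / sinh(t/2). *)
Definition bern_half n : R := (bernoulli_poly R n).[2^-1] / n`!%:R.

Lemma bern_half_gen n :
  fps_mul (fun m => fps_exp 1 m - (m == 0)%:R) bern_half n =
  if n is m.+1 then fps_exp 2^-1 m else 0.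
Proof.
have := congr1 (fun p : {poly R} => p.[2^-1]) (bernoulli_poly_gen R n).
rewrite horner_sum.
have -> : (if n is m.+1 then fps_exp_xt R m else 0).[2^-1] =
    if n is m.+1 then fps_exp 2^-1 m else 0.
  by case: n => [|m]; rewrite ?horner0 // hornerZ hornerXn mulrC.
move=> <-; apply: eq_bigr => i _; rewrite hornerM hornerZ.
rewrite /bern_half [X in _ = _ * X]mulrC; congr (_ * _).
case: (nat_of_ord i) => [|m]; rewrite /fps_exp expr1n ?horner0 ?fact0
   ?divr1 ?subrr //.
by rewrite hornerC subr0 mul1r.
Qed.

(** This is (sinh z / z)(z / sinh z) = 1 in powers of z^2, with t = 2z. Multiplying the generating
    identity by e^(-t/2) gives the odd series e^(t/2) - e^(-t/2), whose product with the Bernoulli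
    series is t. *)
Lemma bern_half_even p :
  fps_mul (fun j => (2 * j).+1`!%:R^-1) (fun i => 4 ^+ i * bern_half (2 * i)) p
  = (p == 0)%:R.
Proof.
pose s i := fps_exp 2^-1 i - fps_exp (- 2^-1) i.
have sE : fps_mul (fps_exp (- 2^-1)) (fun m => fps_exp 1 m - (m == 0)%:R) =1 s.
  move=> n; rewrite /fps_mul.
  under eq_bigr do rewrite mulrBr.
  rewrite sumrB -/(fps_mul _ _ _) fps_expD; congr (_ - _).
    by congr fps_exp; field.
  rewrite big_ord_recr /= subnn mulr1 big1 ?add0r // => i _.
  by rewrite subn_eq0 leqNgt ltn_ord mulr0.
have E n : fps_mul s bern_half n.+1 = (n == 0)%:R.
  rewrite -(eq_fps_mul n.+1 sE (frefl _)) -fps_mulA.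
  rewrite (eq_fps_mul n.+1 (frefl _) bern_half_gen).
  rewrite /fps_mul big_ord_recr /= subnn mulr0 addr0.
  under eq_bigr => i _ do rewrite subSn -1?ltnS //.
  rewrite -/(fps_mul _ _ _) fps_expD addNr /fps_exp expr0n.
  by case: n => [|n]; rewrite ?fact0 ?divr1 ?mul0r.
have := E (2 * p)%N; rewrite /fps_mul.
rewrite (_ : (2 * p).+2 = 2 * p.+1)%N; last by lia.
rewrite (sum_ord_pairs (fun i => s i * bern_half ((2 * p).+1 - i))).
have -> : (2 * p == 0)%N = (p == 0)%N by lia.
move=> Ep; transitivity (4 ^+ p * (p == 0)%:R : R); last first.
  by case: p {Ep E} => [|p]; rewrite ?expr0 ?mulr0 ?mul1r.
rewrite -Ep mulr_sumr; apply: eq_bigr => j _.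
have lejp : (j <= p)%N by rewrite -ltnS.
have signE : (-1) ^+ (2 * j) = 1 :> R by rewrite exprM sqrrN !expr1n.
have -> : s (2 * j)%N = 0 by rewrite /s /fps_exp exprNn signE mul1r subrr.
rewrite mul0r add0r subSS -mulnBr /s /fps_exp exprNn (exprS (-1)) signE.
have -> : 4 ^+ p = 4 ^+ j * 4 ^+ (p - j) :> R by rewrite -exprD subnKC.
have -> : 2^-1 ^+ (2 * j).+1 = 2^-1 * 4 ^- j :> R.
  by rewrite exprS exprM -exprVn; congr (_ * _ ^+ _); field.
have : 4 ^+ j != 0 :> R by rewrite expf_neq0.
move: (natr_fact_neq0 R (2 * j).+1).
move: (_`!%:R : R) (4 ^+ j : R) => x y x0 y0.
by field; rewrite x0 y0.
Qed.

(* The series of (sin z / z) (sinh z / z) in u = z^2. *)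
Definition sinc_sinhc : nat -> R := fps_mul
  (fun j => (-1) ^+ j * (2 * j).+1`!%:R^-1) (fun j => (2 * j).+1`!%:R^-1).

(** The substitution u -> -u exchanges the two factors, so the series is even in u. *)
Lemma sinc_sinhc_odd n : sinc_sinhc (2 * n).+1 = 0.
Proof.
have : sinc_sinhc (2 * n).+1 = - sinc_sinhc (2 * n).+1.
  rewrite /sinc_sinhc [LHS]fps_mulC.
  transitivity ((-1) ^+ (2 * n).+1 * sinc_sinhc (2 * n).+1).
    rewrite -fps_mul_scale; apply: eq_fps_mul => j //.
    by rewrite mulrA -exprMn mulrNN mulr1 expr1n mul1r.
  by rewrite exprS exprM sqrrN !expr1n mulr1 mulN1r.
by move/eqP; rewrite -addr_eq0 -mulr2n mulrn_eq0 => /eqP.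
Qed.

Lemma sinc_sinhc_even m :
  sinc_sinhc (2 * m)%N = (-1) ^+ m * (2 ^+ (2 * m + 1) / (4 * m + 2)`!%:R).
Proof.
rewrite mulrA -sum_alt_bin_odd mulr_suml; apply: eq_bigr => i _.
have lei : (i <= 2 * m)%N by rewrite -ltnS.
have -> : (4 * m + 2 = (2 * i).+1 + (2 * (2 * m - i)).+1)%N by lia.
rewrite natr_bin_fact.
set a := (2 * i).+1; set b := (2 * (2 * m - i)).+1.
move: (natr_fact_neq0 R a) (natr_fact_neq0 R b) (natr_fact_neq0 R (a + b)).
move: (a`!%:R : R) (b`!%:R : R) ((a + b)`!%:R : R) => x y z x0 y0 z0.
by field; rewrite x0 y0 z0.
Qed.

(* The coefficient of z^(4q) in (z / sin z) (z / sinh z). *)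
Definition bern_conv (q : nat) : R := fps_mul
  (fun i => (-1) ^+ i * (4 ^+ i * bern_half (2 * i)))
  (fun i => 4 ^+ i * bern_half (2 * i)) (2 * q).

(** The twist u -> -u of [bern_half_even] gives (sin z / z)(z / sin z) = 1; the product of both
    identities is read at u^(2n). *)
Lemma sinc_sinhc_bern_conv n :
  fps_mul (fun m => sinc_sinhc (2 * m)) bern_conv n = (n == 0)%:R.
Proof.
pose sn j : R := (2 * j).+1`!%:R^-1.
pose b i : R := 4 ^+ i * bern_half (2 * i).
pose tw (a : nat -> R) i := (-1) ^+ i * a i.
have E1 : fps_mul sn b =1 (fun p => (p == 0)%:R) by exact: bern_half_even.
have E2 : fps_mul (tw sn) (tw b) =1 (fun p => (p == 0)%:R).
  move=> p; rewrite fps_mul_scale E1.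
  by case: p => [|p]; rewrite ?expr0 ?mulr0 ?mul1r.
have one_mul a p : fps_mul (fun p : nat => (p == 0)%:R) a p = a p :> R.
  rewrite /fps_mul big_ord_recl mul1r subn0 big1 ?addr0 // => i _.
  by rewrite mul0r.
have : fps_mul sinc_sinhc (fps_mul (tw b) b) (2 * n) = (n == 0)%:R.
  have mulA (u v w : nat -> R) :
      fps_mul u (fps_mul v w) = fps_mul (fps_mul u v) w.
    by apply/funext; exact: fps_mulA.
  have mulC (u v : nat -> R) : fps_mul u v = fps_mul v u.
    by apply/funext; exact: fps_mulC.
  rewrite /sinc_sinhc -mulA (mulA sn) (mulC sn) -(mulA (tw b)) mulA.
  rewrite (eq_fps_mul _ E2 E1) one_mul.
  by have -> : (2 * n == 0)%N = (n == 0)%N by lia.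
move<-; pose F i := sinc_sinhc i * fps_mul (tw b) b (2 * n - i)%N.
(* An extra term of odd index, which is zero, allows the sum to be split into pairs. *)
have <- : \sum_(i < (2 * n).+2) F i =
    fps_mul sinc_sinhc (fps_mul (tw b) b) (2 * n).
  by rewrite big_ord_recr /= [X in _ + X]/F sinc_sinhc_odd mul0r addr0.
rewrite (_ : (2 * n).+2 = 2 * n.+1)%N; last by lia.
rewrite sum_ord_pairs; apply: eq_bigr => i _.
by rewrite /F sinc_sinhc_odd mul0r addr0 -mulnBr.
Qed.

End FormalInverse.

(** * Sums over increasing tuples *)

Section IncreasingTuples.
Variables (R : realType) (k : nat).

(** The shift by one makes subsets of 'I_N encode increasing lists in 1..N. *)
Definition succ_enum N (A : {set 'I_N}) : seq nat :=
  [seq (nat_of_ord j).+1 | j <- enum A].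

Lemma path_succ_enum N (A : {set 'I_N}) : path ltn 0%N (succ_enum A).
Proof.
have sA : sorted ltn (map val (enum A)).
  rewrite -[enum _](eq_filter (mem_enum _)).
  rewrite -(eq_filter (mem_map val_inj _)) -filter_map.
  by rewrite (sorted_filter ltn_trans) // unlock val_ord_enum iota_ltn_sorted.
rewrite /succ_enum (map_comp succn val); case: (map val _) sA => //= x s xs.
by rewrite path_map.
Qed.

Lemma succ_enumK N (A : {set 'I_N}) :
  [set j : 'I_N | (nat_of_ord j).+1 \in succ_enum A]%SET = A.
Proof.
apply/setP => j; rewrite inE mem_map ?mem_enum // => x y [] /val_inj //.
Qed.

Lemma succ_enum_surj N (s : seq nat) : path ltn 0%N s -> all (geq N) s ->
  exists A : {set 'I_N}, succ_enum A = s.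
Proof.
move=> s_inc sN; exists [set j : 'I_N | (nat_of_ord j).+1 \in s]%SET.
have s_pos x : x \in s -> (0 < x)%N.
  by apply/allP; apply: order_path_min s_inc; exact: ltn_trans.
apply: (irr_sorted_eq ltn_trans ltnn).
- exact: path_sorted (path_succ_enum _).
- exact: path_sorted s_inc.
move=> y; apply/mapP/idP => [[j]|ys]; first by rewrite mem_enum inE => + ->.
have y_pos := s_pos _ ys; have yN : (y.-1 < N)%N.
  by rewrite prednK //; exact: (allP sN).
by exists (Ordinal yN); rewrite ?mem_enum ?inE /= prednK.
Qed.

Variable F : seq nat -> R.
Hypothesis F0 : forall s, 0 <= F s.

Lemma esum_bounded_tuples N :
  (\esum_(t in [set t : k.-tuple nat | path ltn 0%N t /\ all (geq N) t])
     (F t)%:E = (\sum_(A : {set 'I_N} | #|A| == k) F (succ_enum A))%:E)%E.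
Proof.
(* The zero tuple is a default, never reached when A has k elements. *)
pose h (A : {set 'I_N}) : k.-tuple nat :=
  insubd (nseq_tuple k 0%N) (succ_enum A).
have hE (A : {set 'I_N}) : #|A| == k -> tval (h A) = succ_enum A.
  by move=> Ak; rewrite /h val_insubd size_map -cardE Ak.
rewrite (reindex_esum [set A : {set 'I_N} | #|A| == k] _ h); last first.
  split.
  - move=> A /= Ak; rewrite hE //; split; first exact: path_succ_enum.
    by apply/allP => _ /mapP[j _ ->]; exact: ltn_ord.
  - move=> A B; rewrite !inE => Ak Bk /= hAB.
    have AB : succ_enum A = succ_enum B by rewrite -!hE // hAB.
    by rewrite -(succ_enumK A) -(succ_enumK B) AB.
  - move=> t /= [t_inc tN]; have [A EA] := succ_enum_surj t_inc tN.
    have Ak : #|A| == k.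
      by rewrite cardE -(size_map (fun j : 'I_N => j.+1)) [map _ _]EA size_tuple.
    by exists A => //; apply: val_inj; rewrite [LHS]hE.
rewrite esum_fset; last 2 first.
- exact: finite_finset.
- by move=> A _; rewrite lee_fin.
rewrite -sumEFin [RHS]bigfs ?index_enum_uniq //; last first.
  by move=> A _; rewrite mem_index_enum.
by apply: eq_fsbigr => A; rewrite inE => Ak; rewrite hE.
Qed.

(** The terms are nonnegative, so the sum is a supremum over finite sets, and each such set has its
    entries bounded by some N. *)
Lemma esum_increasing_tuples (L : R) :
  (fun N => \sum_(A : {set 'I_N} | #|A| == k) F (succ_enum A)) @ \oo --> L ->
  (\esum_(t in [set t : k.-tuple nat | path ltn 0%N t]) (F t)%:E = L%:E)%E.
Proof.
set S := (S in S @ _ --> _) => cS.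
pose T N := [set t : k.-tuple nat | path ltn 0%N t /\ all (geq N) t].
have nT N M : (N <= M)%N -> T N `<=` T M.
  move=> leNM t [t_inc /allP tN]; split=> //; apply/allP => x /tN /= xN.
  exact: leq_trans leNM.
have sub_esum (A B : set (k.-tuple nat)) : A `<=` B ->
    (\esum_(t in A) (F t)%:E <= \esum_(t in B) (F t)%:E)%E.
  move=> AB; apply: ge_ereal_sup => _ [X [finX XA] <-].
  by apply: esum_ge; exists X => //; split=> //; exact: subset_trans AB.
have leSL N : S N <= L.
  rewrite -(cvg_lim _ cS) //; apply: nondecreasing_cvgn_le.
    by move=> i j ij; rewrite -lee_fin -!esum_bounded_tuples; exact/sub_esum/nT.
  by apply/cvg_ex; exists L.
apply/eqP; rewrite eq_le; apply/andP; split.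
  apply: ge_ereal_sup => _ [X [finX XT] <-].
  have [N XN] : exists N, X `<=` T N.
    have /finite_seqP[s EX] := finX.
    exists (\max_(t <- s) \max_(x <- tval t) x)%N => t Xt.
    split; first exact: XT.
    apply/allP => x xt; move: Xt; rewrite EX /= => ts.
    apply: (@leq_trans (\max_(x <- tval t) x)%N).
      exact: (@leq_bigmax_seq _ _ xpredT id).
    exact: (@leq_bigmax_seq _ _ xpredT
      (fun t : k.-tuple nat => \max_(x <- tval t) x)%N).
  apply: (@le_trans _ _ (S N)%:E); last by rewrite lee_fin.
  by rewrite -esum_bounded_tuples; apply: esum_ge; exists X.
have : forall N, ((S N)%:E <=
    \esum_(t in [set t : k.-tuple nat | path ltn 0%N t]) (F t)%:E)%E.
  move=> N; rewrite -esum_bounded_tuples; apply: sub_esum => t /=.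
  by case.
case: (esum _ _) => [r| |] H; rewrite ?leey //; last by have := H 0%N.
rewrite lee_fin; apply: (cvgr_to_le cS); near=> N; rewrite -lee_fin; exact: H.
Unshelve. all: by end_near. Qed.

End IncreasingTuples.

(** * The limiting recursion *)

(** Distributing the product picks an exponent between 1 and n in each factor, which produces the
    compositions of n. *)
Lemma coef_prod_geom_trunc (R : comNzRingType) n k (y : 'I_k -> R) :
  (\prod_(i < k) geom_trunc n (y i))`_n =
  \sum_(a : {ffun 'I_k -> 'I_n.+1} |
      [forall i, (1 <= a i)%N] && (\sum_(i < k) a i == n)%N)
    \prod_(i < k) y i ^+ a i.
Proof.
rewrite /geom_trunc (bigA_distr_big (fun a : 'I_n.+1 => (0 < a)%N)) coef_sum.
rewrite big_mkcond [RHS]big_mkcond; apply: eq_bigr => a _.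
have -> : (a \in ffun_on (fun a : 'I_n.+1 => (0 < a)%N)) =
    [forall i, (1 <= a i)%N].
  by apply/ffun_onP/forallP.
case: ifP => //= _.
rewrite scaler_prod prodrXr coefZ coefXn eq_sym.
by case: eqP => _; rewrite ?mulr1 ?mulr0.
Qed.

Section MainLimit.
Variable R : realType.

(* The value of zeta(4, ..., 4) at depth m. *)
Definition zeta4s m : R := 2 ^+ (2 * m + 1) * pi ^+ (4 * m) / (4 * m + 2)`!%:R.

Definition zeta4s_alt k m : R := (-1) ^+ (m - k) * 'C(m, k)%:R * zeta4s m.

(** The inverse of the series sum (-1)^m [zeta4s] m t^m, times the limiting right-hand side. *)
Definition lim_sum k : nat -> R :=
  fps_mul (fun q => pi ^+ 4 ^+ q * bern_conv R q) (zeta4s_alt k).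

Lemma lim_sum_rec k p :
  \sum_(i < p.+1) (-1) ^+ i * zeta4s i * lim_sum k (p - i) = zeta4s_alt k p.
Proof.
transitivity (fps_mul (fun m => pi ^+ 4 ^+ m * sinc_sinhc R (2 * m))
    (lim_sum k) p).
  apply: eq_bigr => i _; congr (_ * _).
  by rewrite sinc_sinhc_even /zeta4s -exprM; ring.
rewrite fps_mulA [LHS]big_ord_recl big1 => [|i _].
  by rewrite fps_mul_scale sinc_sinhc_bern_conv expr0 !mul1r addr0 subn0.
by rewrite fps_mul_scale sinc_sinhc_bern_conv mulr0 mul0r.
Qed.

(** Strong induction on p: as e_0 = 1, the finite recursion and its limit [lim_sum_rec] both solve
    for index p from smaller indices. *)
Lemma cvg_esym_geom_trunc n k p : (p <= n)%N ->
  (fun N => ((esym_poly (fun j => geom_trunc n (j.+1%:R ^- 4 : R)) N)`_k)`_p)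
    @ \oo --> lim_sum k p.
Proof.
elim/ltn_ind: p => p IHp lepn.
have z0 : zeta4s 0 = 1 by rewrite /zeta4s muln0 expr0 mulr1 divff.
pose e N := esym_poly (fun j => j.+1%:R ^- 4 : R) N.
pose W N := (esym_poly (fun j => geom_trunc n (j.+1%:R ^- 4 : R)) N)`_k.
have -> : lim_sum k p = zeta4s_alt k p -
    \sum_(i < p) (-1) ^+ i.+1 * zeta4s i.+1 * lim_sum k (p - i.+1).
  by rewrite -lim_sum_rec big_ord_recl expr0 z0 !mul1r subn0 addrK.
have -> : (fun N => (W N)`_p) = (fun N =>
    (-1) ^+ (p - k) * 'C(p, k)%:R * (e N)`_p -
    \sum_(i < p) (-1) ^+ i.+1 * (e N)`_i.+1 * (W N)`_(p - i.+1)).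
  apply/funext => N.
  rewrite -(esym_poly_geom_trunc (fun j => j.+1%:R ^- 4 : R) N k lepn).
  by rewrite big_ord_recl expr0 esym_poly0 !mul1r subn0 addrK.
apply: cvgB; first by apply: cvgM; [exact: cvg_cst|exact: cvg_esym_4].
apply: cvgr_sum => i _; apply: cvgM.
  by apply: cvgM; [exact: cvg_cst|exact: cvg_esym_4].
by apply: IHp; have := ltn_ord i; lia.
Qed.

Lemma lim_sumE n k : (k <= n)%N -> lim_sum k n =
  2 ^+ (2 * n + 1) * pi ^+ (4 * n) / ((4 * n + 2)`!)%:R *
     \sum_(0 <= q < (n - k).+1)
       (-1) ^+ (n - q - k) * 'C(n - q, k)%:R * 'C(4 * n + 2, 4 * q)%:R *
       \sum_(q1 < (2 * q).+1) \sum_(q2 < (2 * q).+1 | (q1 + q2 == 2 * q)%N)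
         'C(4 * q, 2 * q1)%:R * (-1) ^+ q1 * 2 ^+ (2 * q) *
         (bernoulli_poly R (2 * q1)).[2^-1] *
         (bernoulli_poly R (2 * q2)).[2^-1].
Proof.
move=> lekn; pose term q := pi ^+ 4 ^+ q * bern_conv R q * zeta4s_alt k (n - q).
have -> : lim_sum k n = \sum_(0 <= q < (n - k).+1) term q.
  rewrite /lim_sum /fps_mul -(big_mkord xpredT term).
  (* For q > n - k the binomial C(n-q, k) is zero. *)
  rewrite (big_cat_nat _ (n := (n - k).+1)) //=; last by lia.
  rewrite [X in _ + X]big_nat_cond [X in _ + X]big1 ?addr0 // => q.
  rewrite andbT => /andP[lq qn]; rewrite /term /zeta4s_alt bin_small; last by lia.
  by rewrite mulr0 mul0r mulr0.
rewrite mulr_sumr; apply: eq_big_nat => q /andP[_ qn].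
have -> : \sum_(q1 < (2 * q).+1) \sum_(q2 < (2 * q).+1 | (q1 + q2 == 2 * q)%N)
         'C(4 * q, 2 * q1)%:R * (-1) ^+ q1 * 2 ^+ (2 * q) *
         (bernoulli_poly R (2 * q1)).[2^-1] *
         (bernoulli_poly R (2 * q2)).[2^-1] =
    (4 * q)`!%:R / 2 ^+ (2 * q) * bern_conv R q.
  rewrite /bern_conv /fps_mul mulr_sumr; apply: eq_bigr => q1 _.
  have leq1 : (q1 <= 2 * q)%N by rewrite -ltnS.
  rewrite (big_pred1 (inord (2 * q - q1))) => [|q2]; last first.
    by rewrite /= -val_eqE /= inordK ?ltnS ?leq_subr //; lia.
  rewrite inordK ?ltnS ?leq_subr // /bern_half.
  have := @natr_bin_fact R (2 * q1) (2 * (2 * q - q1)).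
  have -> : (2 * q1 + 2 * (2 * q - q1) = 4 * q)%N by lia.
  move->.
  (* Of this 2^(4q), one half is the 2^(2q) of the statement and the other cancels the
     denominator. *)
  have E4 : 4 ^+ q1 * 4 ^+ (2 * q - q1) = 2 ^+ (2 * q) * 2 ^+ (2 * q) :> R.
    rewrite -exprD subnKC // -exprMn; congr (_ ^+ _); ring.
  have := natr_fact_neq0 R (2 * q1); have := natr_fact_neq0 R (2 * (2 * q - q1)).
  have : 2 ^+ (2 * q) != 0 :> R by rewrite expf_neq0.
  set u := (_.[_]); set v := (_.[_]).
  move: E4; move: (4 ^+ q1 : R) (4 ^+ (2 * q - q1) : R) (2 ^+ (2 * q) : R).
  move: ((2 * q1)`!%:R : R) ((2 * (2 * q - q1))`!%:R : R) ((4 * q)`!%:R : R).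
  move: ((-1) ^+ q1 : R) => s f1 f2 f a b t E4 t0 f10 f20.
  transitivity (f / t * (a * b) * (s * (u / f1) * (v / f2))); last by ring.
  by rewrite E4; field; rewrite t0 f10 f20.
rewrite /term /zeta4s_alt /zeta4s.
(* This binomial trades (4n+2)! for (4q)! and the denominator of [zeta4s] (n-q). *)
have := @natr_bin_fact R (4 * q) (4 * (n - q) + 2).
have -> : (4 * q + (4 * (n - q) + 2) = 4 * n + 2)%N by lia.
move->.
have -> : 2 ^+ (2 * n + 1) = 2 ^+ (2 * q) * 2 ^+ (2 * (n - q) + 1) :> R.
  by rewrite -exprD; congr (_ ^+ _); lia.
have -> : pi ^+ (4 * n) = pi ^+ 4 ^+ q * pi ^+ (4 * (n - q)) :> R.
  by rewrite -exprM -exprD; congr (_ ^+ _); lia.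
have := natr_fact_neq0 R (4 * n + 2); have := natr_fact_neq0 R (4 * q).
have := natr_fact_neq0 R (4 * (n - q) + 2).
have : 2 ^+ (2 * q) != 0 :> R by rewrite expf_neq0.
move: (2 ^+ (2 * q) : R) (2 ^+ (2 * (n - q) + 1) : R) (bern_conv R q) => t w g.
move: ((4 * n + 2)`!%:R : R) ((4 * q)`!%:R : R) ((4 * (n - q) + 2)`!%:R : R).
move: (pi ^+ 4 ^+ q : R) (pi ^+ (4 * (n - q)) : R) ('C(n - q, k)%:R : R).
move: ((-1) ^+ (n - q - k) : R) => s p1 p2 c f f1 f2 t0 f20 f10 f0.
by field; rewrite t0 f0 f10 f20.
Qed.

End MainLimit.

Theorem theoremC (R : realType) (n k : nat) (hk : (1 <= k)%N) (hkn : (k <= n)%N) :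
  (\sum_(a : {ffun 'I_k -> 'I_n.+1} |
         [forall i, (1 <= a i)%N] && (\sum_(i < k) a i == n)%N)
     mzv R (fun i => (4 * a i)%N))%E
  = (2 ^+ (2 * n + 1) * pi ^+ (4 * n) / ((4 * n + 2)`!)%:R *
     \sum_(0 <= q < (n - k).+1)
       (-1) ^+ (n - q - k) * 'C(n - q, k)%:R * 'C(4 * n + 2, 4 * q)%:R *
       \sum_(q1 < (2 * q).+1) \sum_(q2 < (2 * q).+1 | (q1 + q2 == 2 * q)%N)
         'C(4 * q, 2 * q1)%:R * (-1) ^+ q1 * 2 ^+ (2 * q) *
         (bernoulli_poly R (2 * q1)).[2^-1] *
         (bernoulli_poly R (2 * q2)).[2^-1])%:E.
Proof.
rewrite -lim_sumE //.
pose F (s : seq nat) : R := \sum_(a : {ffun 'I_k -> 'I_n.+1} |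
    [forall i, (1 <= a i)%N] && (\sum_(i < k) a i == n)%N)
  \prod_(i < k) ((nth 0 s i)%:R ^- 4) ^+ a i.
have F0 s : 0 <= F s.
  apply: sumr_ge0 => a _; apply: prodr_ge0 => i _.
  by rewrite exprn_ge0 // invr_ge0 exprn_ge0.
(* Nonnegativity allows the finite sum over compositions to move inside the sum over tuples. *)
rewrite /mzv -esum_sum; last first.
  by move=> t a _ _; rewrite lee_fin prodr_ge0 // => i _;
    rewrite invr_ge0 exprn_ge0.
transitivity (\esum_(t in [set t : k.-tuple nat | path ltn 0%N t]) (F t)%:E)%E.
  apply: eq_esum => t _; rewrite sumEFin; congr (_%:E).
  apply: eq_bigr => a _; apply: eq_bigr => i _.
  by rewrite exprVn -exprM (tnth_nth 0%N).
apply: esum_increasing_tuples => //.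
(* The sum over k-subsets is the coefficient of t^n y^k in the truncated generating function. *)
have -> : (fun N => \sum_(A : {set 'I_N} | #|A| == k) F (succ_enum A)) =
    (fun N => ((esym_poly (fun j => geom_trunc n (j.+1%:R ^- 4 : R)) N)`_k)`_n).
  apply/funext => N; apply/esym.
  rewrite coef_esym_poly coef_sum; apply: eq_bigr => A /eqP Ak.
  have sz : size (succ_enum A) = k by rewrite size_map -cardE.
  rewrite /F -coef_prod_geom_trunc.
  congr ((_ : {poly R})`_n); rewrite -big_enum /=.
  transitivity (\prod_(m <- succ_enum A) geom_trunc n (m%:R ^- 4 : R)).
    by rewrite big_map.
  by rewrite (big_nth 0%N) big_mkord sz.
exact: cvg_esym_geom_trunc.
Qed.
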